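(* Let $1\le p<\infty$, let $d_{w,p}$ be a Lorentz sequence space and let $T\in L(d_{w,p})$. If $T$ is not strictly singular, then $J^{\ell_p}\subseteq J_T$.
   Context: Let $1\le p<\infty$ and let $w=(w_n)$ be a real sequence with $w_1=1$, $w_n\downarrow 0$ and $\sum_n w_n=\infty$. The Lorentz sequence space $d_{w,p}$ is the Banach space of all $x=(x_n)\in c_0$ with $\|x\|_{d_{w,p}}=\big(\sum_{n}w_n (x^*_n)^p\big)^{1/p}<\infty$, where $(x^*_n)$ is the non-increasing rearrangement of $(|x_n|)$. An operator is strictly singular if its restriction to no infinite-dimensional closed subspace is an isomorphism. $J_T=\{\sum_{i=1}^n A_iTB_i: n\in\mathbb N, A_i,B_i\in L(d_{w,p})\}$ is the ideal generated by $T$. $J^{\ell_p}$ is the set of operators $S\in L(d_{w,p})$ of the form $S=BA$ with $A\in L(d_{w,p},\ell_p)$, $B\in L(\ell_p,d_{w,p})$. *)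

(* Defs.v *)
From mathcomp Require Import all_boot all_order all_algebra.
From mathcomp Require Import all_classical all_reals all_analysis.
Set Implicit Arguments. Unset Strict Implicit. Unset Printing Implicit Defensive.
Import Order.TTheory GRing.Theory Num.Theory numFieldNormedType.Exports.
Local Open Scope classical_set_scope.
Local Open Scope ring_scope.

Section LorentzDefs.
Variable R : realType.

Definition seqR := nat -> R.

Definition c0 : set seqR := [set x : seqR | (x n) @[n --> \oo] --> (0 : R)].

(* non-increasing rearrangement (0-indexed): x^*_n = the (n+1)-th largest |x_k|,
   i.e. inf over sets s of (at most) n indices of sup_{k not in s} |x_k| *)
Definition drearr (x : seqR) (n : nat) : R :=
  inf [set sup [set `|x k| | k in [set k | k \notin s]] | s in [set s : seq nat | size s = n]].

Definition lorentz_sum (w : seqR) (p : R) (x : seqR) : \bar R :=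
  (\sum_(0 <= n <oo) ((w n * (drearr x n `^ p))%:E))%E.

Definition dwp (w : seqR) (p : R) : set seqR :=
  [set x | c0 x /\ (lorentz_sum w p x < +oo)%E].

Definition dwp_norm (w : seqR) (p : R) (x : seqR) : R :=
  (fine (lorentz_sum w p x)) `^ (p^-1).

Definition lp_sum (p : R) (x : seqR) : \bar R :=
  (\sum_(0 <= n <oo) ((`|x n| `^ p)%:E))%E.

Definition lp (p : R) : set seqR := [set x | (lp_sum p x < +oo)%E].

Definition lp_norm (p : R) (x : seqR) : R := (fine (lp_sum p x)) `^ (p^-1).

Definition bounded_op (X : set seqR) (nX : seqR -> R) (Y : set seqR)
    (nY : seqR -> R) (T : seqR -> seqR) : Prop :=
  [/\ (forall x, X x -> Y (T x)),
      (forall (a b : R) x y, X x -> X y ->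
         T (fun k => a * x k + b * y k) = (fun k => a * T x k + b * T y k)) &
      exists C : R, forall x, X x -> nY (T x) <= C * nX x].

Definition lin_subspace (M : set seqR) : Prop :=
  M (fun _ => 0) /\
  forall (a b : R) x y, M x -> M y -> M (fun k => a * x k + b * y k).

Definition norm_closed_in (X : set seqR) (nX : seqR -> R) (M : set seqR) : Prop :=
  forall (u : nat -> seqR) x, (forall m, M (u m)) -> X x ->
    (nX (fun k => u m k - x k)) @[m --> \oo] --> (0 : R) -> M x.

Definition infinite_dim (M : set seqR) : Prop :=
  forall n : nat, exists v : 'I_n -> seqR,
    (forall i, M (v i)) /\
    forall c : 'I_n -> R, (forall k, \sum_(i < n) c i * v i k = 0) -> forall i, c i = 0.

Definition iso_on (nX : seqR -> R) (T : seqR -> seqR) (M : set seqR) : Prop :=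
  exists c : R, 0 < c /\ forall x, M x -> c * nX x <= nX (T x).

Definition strictly_singular (X : set seqR) (nX : seqR -> R) (T : seqR -> seqR) : Prop :=
  forall M : set seqR, M `<=` X -> lin_subspace M -> norm_closed_in X nX M ->
    infinite_dim M -> ~ iso_on nX T M.

Definition in_JT (w : seqR) (p : R) (T S : seqR -> seqR) : Prop :=
  exists (n : nat) (A B : 'I_n -> seqR -> seqR),
    (forall i, bounded_op (dwp w p) (dwp_norm w p) (dwp w p) (dwp_norm w p) (A i)) /\
    (forall i, bounded_op (dwp w p) (dwp_norm w p) (dwp w p) (dwp_norm w p) (B i)) /\
    forall x, dwp w p x -> S x = (fun k => \sum_(i < n) A i (T (B i x)) k).

Definition in_Jlp (w : seqR) (p : R) (S : seqR -> seqR) : Prop :=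
  exists A B : seqR -> seqR,
    [/\ bounded_op (dwp w p) (dwp_norm w p) (lp p) (lp_norm p) A,
        bounded_op (lp p) (lp_norm p) (dwp w p) (dwp_norm w p) B &
        forall x, dwp w p x -> S x = B (A x)].

End LorentzDefs.

(* Main.v *)
Require Import Defs.
From mathcomp Require Import all_boot all_order all_algebra.
From mathcomp Require Import all_classical all_reals all_analysis.
From mathcomp Require Import ring lra.
Set Implicit Arguments. Unset Strict Implicit. Unset Printing Implicit Defensive.
Import Order.TTheory GRing.Theory Num.Theory numFieldNormedType.Exports.
Local Open Scope classical_set_scope.
Local Open Scope ring_scope.

(* It suffices to factor the identity of l_p as V T U with U : l_p -> d_{w,p} and
   V : d_{w,p} -> l_p bounded, since then S = B A = (B V) T (U A).

   Let T be an isomorphism on the infinite-dimensional subspace M. By linear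
   algebra M contains vectors x such that x and T x both vanish on any given
   initial segment. Among them some are normalized with sup |T x| as small as
   desired, because sums of n almost disjoint images of fixed height have
   bounded sup norm but Lorentz norm of order (w_0 + ... + w_(n-1))^(1/p). A
   gliding hump then gives x_i in M such that (x_i) and (y_i) = (T x_i) are
   perturbed block sequences and sup |y_i| -> 0 so fast that a fixed share of
   the norm of y_i is carried by the weights beyond the total length of the
   previous blocks.

   U a = sum a_i x_i is bounded because blocks in d_{w,p} have an upper
   p-estimate. The norming functionals f_i of y_i that use only those late
   weights share the weights disjointly, so z |-> (f_i z)_i is bounded into l_p.
   The matrix (f_i y_j) is lower triangular, with diagonal bounded below and
   small entries off it; V is obtained from (f_i z)_i by forward substitution. *)

(** * Weighted sums along lists of positions *)

Section WeightedSums.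
Variable R : realType.
Variable w : nat -> R.
Implicit Types (a b : nat -> R) (s r : seq nat) (N n k : nat).

Fixpoint wsum a N s : R :=
  if s is k :: s' then w N * a k + wsum a N.+1 s' else 0.

Lemma wsum_cat a N s r : wsum a N (s ++ r) = wsum a N s + wsum a (N + size s) r.
Proof.
elim: s N => [|k s IH] N /=; first by rewrite add0r addn0.
by rewrite IH addrA addSnnS.
Qed.

Lemma wsumD a b N s : wsum (fun k => a k + b k) N s = wsum a N s + wsum b N s.
Proof. by elim: s N => [|k s IH] N /=; rewrite ?addr0 // IH; ring. Qed.

Lemma wsumZ c a N s : wsum (fun k => c * a k) N s = c * wsum a N s.
Proof. by elim: s N => [|k s IH] N /=; rewrite ?mulr0 // IH; ring. Qed.

Lemma wsum_sum I (r : seq I) (F : I -> nat -> R) N s :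
  wsum (fun k => \sum_(i <- r) F i k) N s = \sum_(i <- r) wsum (F i) N s.
Proof.
elim: s N => [|k s IH] N /=; first by rewrite big1.
by rewrite IH mulr_sumr big_split.
Qed.

Lemma eq_wsum a b N s : (forall k, k \in s -> a k = b k) ->
  wsum a N s = wsum b N s.
Proof.
elim: s N => [//|k s IH] N /= ab; rewrite ab ?mem_head//; congr (_ + _).
by apply: IH => j js; apply: ab; rewrite inE js orbT.
Qed.

Lemma wsum_mkseq a (g : nat -> nat) n :
  wsum a 0 (mkseq g n) = \sum_(j < n) w j * a (g j).
Proof.
elim: n => [|n IH]; first by rewrite big_ord0.
by rewrite big_ord_recr mkseqS -cats1 wsum_cat -IH size_mkseq /= addr0.
Qed.

Lemma wsum_nth a s :
  wsum a 0 s = \sum_(j < size s) w j * a (nth 0%N s j).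
Proof. by rewrite -wsum_mkseq mkseq_nth. Qed.

Hypothesis w_ge0 : forall n, 0 <= w n.

Lemma ler_wsum a b N s : (forall k, k \in s -> a k <= b k) ->
  wsum a N s <= wsum b N s.
Proof.
elim: s N => [//|k s IH] N /= ab; apply: lerD.
  by rewrite ler_wpM2l ?ab ?mem_head.
by apply: IH => j js; apply: ab; rewrite inE js orbT.
Qed.

Lemma wsum_ge0 a N s : (forall k, 0 <= a k) -> 0 <= wsum a N s.
Proof. by move=> a0; elim: s N => [//|k s IH] N /=; rewrite addr_ge0 ?mulr_ge0. Qed.

Hypothesis w_dec : forall n, w n.+1 <= w n.

Lemma weight_anti m n : (m <= n)%N -> w n <= w m.
Proof.
move=> /subnK <-; elim: (n - m)%N => [//|k IH].
by rewrite addSn (le_trans _ IH).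
Qed.

Lemma wsum_anti a M N s : (forall k, 0 <= a k) -> (M <= N)%N ->
  wsum a N s <= wsum a M s.
Proof.
move=> a0; elim: s M N => [//|k s IH] M N MN /=; apply: lerD; last exact: IH.
by rewrite ler_wpM2r ?weight_anti.
Qed.

Lemma wsum_filter a (P : pred nat) N s : (forall k, 0 <= a k) ->
  (forall k, k \in s -> ~~ P k -> a k = 0) ->
  wsum a N s <= wsum a N [seq k <- s | P k].
Proof.
move=> a0; elim: s N => [//|k s IH] N /= h.
have {}IH := IH _ (fun j js => h j (mem_behead (s := k :: s) js)).
case: ifPn => Pk /=; first by rewrite lerD2l.
rewrite h ?mem_head// mulr0 add0r (le_trans (IH _))//.
exact: wsum_anti.
Qed.

Lemma wsum_upper a (e : R) s : 0 <= e -> (forall k, k \in s -> a k <= e) ->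
  wsum a 0 s <= e * \sum_(j < size s) w j.
Proof.
move=> e0 ae; rewrite (le_trans (ler_wsum _ ae))// wsum_nth mulr_sumr.
by apply: ler_sum => j _; rewrite mulrC.
Qed.

Lemma wsum_lower a (e : R) s : 0 <= e -> (forall k, k \in s -> e <= a k) ->
  e * \sum_(j < size s) w j <= wsum a 0 s.
Proof.
move=> e0 ae; apply: le_trans (ler_wsum _ ae); rewrite wsum_nth mulr_sumr.
by apply: ler_sum => j _; rewrite mulrC.
Qed.

Lemma abel_ler_sum (u v : nat -> R) n :
  (forall m, (m <= n)%N -> \sum_(j < m) u j <= \sum_(j < m) v j) ->
  \sum_(j < n) w j * u j <= \sum_(j < n) w j * v j.
Proof.
move=> uv; suff : w n * (\sum_(j < n) v j - \sum_(j < n) u j) <=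
    \sum_(j < n) w j * v j - \sum_(j < n) w j * u j.
  move=> h; rewrite -subr_ge0; apply: le_trans h.
  by rewrite mulr_ge0 // subr_ge0 uv.
elim: n uv => [|n IH] uv; first by rewrite !big_ord0 subrr mulr0.
have {}IH := IH (fun m mn => uv m (leqW mn)).
have := uv n.+1 (leqnn _); rewrite !big_ord_recr /= => uvn.
set V := \sum_(j < n) v j in IH uvn *; set U := \sum_(j < n) u j in IH uvn *.
have h : w n.+1 * (V + v n - (U + u n)) <= w n * (V + v n - (U + u n)).
  by rewrite ler_wpM2r // subr_ge0.
rewrite (le_trans h) //; move: IH; set A := \sum_(_ < _) _; set B := \sum_(_ < _) _.
by move=> IH; lra.
Qed.

(* [g] need not be onto: if [a] is positive infinitely often, its zeros are never listed. *)
Definition greedy a (g : nat -> nat) :=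
  injective g /\ forall n k, (forall j, (j < n)%N -> g j != k) -> a k <= a (g n).

Lemma greedy_top_sum a g s : greedy a g -> uniq s ->
  \sum_(k <- s) a k <= \sum_(j < size s) a (g j).
Proof.
move=> [ginj gmax] us; set n := size s; set t := a (g n).
have gs : uniq (mkseq g n) by rewrite mkseq_uniq.
have gt j : (j <= n)%N -> t <= a (g j).
  move=> jn; apply: gmax => i ij; apply/eqP => /ginj e.
  by move: ij jn; rewrite e; case: ltngtP.
pose h k := Num.max (a k - t) 0.
have h0 k : 0 <= h k by rewrite le_max lexx orbT.
suff : \sum_(k <- s) (a k - t) <= \sum_(j < n) (a (g j) - t).
  rewrite !sumrB [X in _ - X <= _]big_const_seq count_predT iter_addr_0.
  by rewrite sumr_const card_ord lerD2r.
apply: (@le_trans _ _ (\sum_(k <- s) h k)).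
  by apply: ler_sum => k _; rewrite le_max lexx.
apply: (@le_trans _ _ (\sum_(k <- mkseq g n) h k)); last first.
  rewrite big_map -{1}(subn0 n) -/(index_iota _ _) big_mkord; apply: ler_sum => j _.
  by rewrite /h ge_max lexx /= subr_ge0 gt// ltnW.
rewrite (bigID (fun k => k \in mkseq g n)) /= [X in _ + X]big1 ?addr0; last first.
  move=> k kg; rewrite /h; apply/max_idPr; rewrite subr_le0; apply: gmax => j jn.
  by apply: contraNneq kg => <-; apply/mapP; exists j => //; rewrite mem_iota.
rewrite -big_filter [leRHS](bigID (fun k => k \in s)) /=.
rewrite -[X in X <= _]addr0 lerD ?sumr_ge0//.
rewrite -(big_filter (mkseq g n)) (perm_big [seq k <- mkseq g n | k \in s])//.
apply: uniq_perm; rewrite ?filter_uniq// => k.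
by rewrite !mem_filter andbC.
Qed.

Lemma greedy_wsum a g s : greedy a g -> uniq s ->
  wsum a 0 s <= wsum a 0 (mkseq g (size s)).
Proof.
move=> ag us; rewrite wsum_nth wsum_mkseq.
apply: (abel_ler_sum (u := fun j => a (nth 0%N s j)) (v := fun j => a (g j))).
move=> m ms; have sz : size (take m s) = m by rewrite size_takel.
have := greedy_top_sum ag (take_uniq m us); rewrite sz.
rewrite (big_nth 0%N) sz big_mkord; under eq_bigr do rewrite nth_take//.
exact.
Qed.

End WeightedSums.

(** * Infinite lower triangular systems *)

Section Triangular.
Variables (R : realType) (F : nat -> nat -> R).
Hypothesis F_diag : forall i, F i i != 0.

Lemma triangular_inj (a b : seqR R) :
  (forall i, \sum_(j < i.+1) F i j * a j = \sum_(j < i.+1) F i j * b j) ->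
  a = b.
Proof.
move=> ab; apply/funext; elim/ltn_ind => i IH.
have := ab i; rewrite !big_ord_recr /=.
rewrite (eq_bigr (fun j : 'I_i => F i j * b j)); last by move=> j _; rewrite IH.
by move=> /addrI /(mulfI (F_diag i)).
Qed.

Fixpoint forward_subst (b : seqR R) n : seqR R :=
  if n is m.+1 then fun i =>
    if i == m then (b m - \sum_(j < m) F m j * forward_subst b m j) / F m m
    else forward_subst b m i
  else fun _ => 0.

Lemma triangular_surj (b : seqR R) :
  exists a : seqR R, forall i, \sum_(j < i.+1) F i j * a j = b i.
Proof.
have stable n i : (i < n)%N -> forward_subst b n i = forward_subst b i.+1 i.
  elim: n => [//|n IH]; rewrite ltnS leq_eqVlt => /predU1P[->//|lt_in].
  by rewrite [LHS]/= ltn_eqF// IH.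
exists (fun i => forward_subst b i.+1 i) => i; rewrite big_ord_recr [X in F i i * X]/= eqxx.
rewrite [F i i * _]mulrC divfK// (eq_bigr (fun j : 'I_i => F i j * forward_subst b i j)).
  by rewrite /= addrC subrK.
by move=> j _; rewrite [in RHS]stable.
Qed.

End Triangular.

(** * Power inequalities and l_p sums *)

Section Powers.
Variables (R : realType) (p : R).
Hypothesis p_ge1 : 1 <= p.
Let p0 : 0 < p := lt_le_trans ltr01 p_ge1.

Lemma powR_normD (u v : R) : `|u + v| `^ p <= 2 `^ p * (`|u| `^ p + `|v| `^ p).
Proof.
wlog uv : u v / `|v| <= `|u|.
  move=> h; case: (leP `|v| `|u|) => [|/ltW]; first exact: h.
  by move=> /h; rewrite addrC [X in _ * X]addrC.
apply: (@le_trans _ _ ((2 * `|u|) `^ p)).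
  apply: ge0_ler_powR; rewrite ?nnegrE ?(ltW p0)//.
  by rewrite (le_trans (ler_normD _ _))// mulr2n mulrDl mul1r lerD2l.
by rewrite powRM// ler_wpM2l ?powR_ge0// lerDl powR_ge0.
Qed.

Lemma powR_norm_sum n (u : 'I_n -> R) :
  `|\sum_(i < n) u i| `^ p <= \sum_(i < n) (2 `^ p) ^+ i.+1 * `|u i| `^ p.
Proof.
elim: n u => [|n IH] u; first by rewrite !big_ord0 normr0 powR0 ?gt_eqF.
rewrite !big_ord_recl (le_trans (powR_normD _ _))// mulrDr expr1 lerD2l.
apply: (le_trans (ler_wpM2l (powR_ge0 _ _) (IH _))).
by rewrite mulr_sumr; apply: ler_sum => i _; rewrite mulrA -exprS.
Qed.

Lemma powR_rootK (c : R) : 0 <= c -> (c `^ p^-1) `^ p = c.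
Proof. by move=> c0; rewrite -powRrM mulVf ?gt_eqF// powRr1. Qed.

Lemma powR_root_le (a b C : R) : 0 <= a -> 0 <= b ->
  a `^ p^-1 <= C * b `^ p^-1 -> a <= `|C| `^ p * b.
Proof.
move=> a0 b0 h; rewrite -(powR_rootK a0) -(powR_rootK b0) -powRM ?powR_ge0//.
apply: ge0_ler_powR; rewrite ?nnegrE ?powR_ge0 ?mulr_ge0 ?powR_ge0 ?(ltW p0)//.
by rewrite (le_trans h)// ler_wpM2r ?powR_ge0 ?ler_norm.
Qed.

Lemma powR_root_mono (a b C : R) : 0 <= a -> 0 <= b -> 0 <= C ->
  a <= C * b -> a `^ p^-1 <= C `^ p^-1 * b `^ p^-1.
Proof.
move=> a0 b0 C0 h; rewrite -powRM//.
by apply: ge0_ler_powR; rewrite ?nnegrE ?mulr_ge0// invr_ge0 ltW.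
Qed.

Lemma powR_norm_lin_le1 (u v : R) : 0 <= u -> 0 <= v ->
  u `^ (p - 1) * v <= u `^ p + v `^ p.
Proof.
move=> u0 v0; case: (leP v u) => uv.
  rewrite (@le_trans _ _ (u `^ p)) ?lerDl ?powR_ge0//.
  by rewrite -[leRHS]mulr_powRB1// mulrC ler_wpM2r ?powR_ge0.
rewrite (@le_trans _ _ (v `^ p)) ?lerDr ?powR_ge0//.
rewrite -[leRHS]mulr_powRB1// mulrC ler_wpM2l//.
by apply: ge0_ler_powR; rewrite ?nnegrE ?subr_ge0// ltW.
Qed.

End Powers.

Section EllP.
Variables (R : realType) (p : R).
Implicit Types x : seqR R.

Lemma lp_sum_ge0 x : (0 <= lp_sum p x)%E.
Proof. by apply: nneseries_ge0 => n _ _; rewrite lee_fin powR_ge0. Qed.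

Lemma partial_le_lp x n : lp p x ->
  \sum_(i < n) `|x i| `^ p <= fine (lp_sum p x).
Proof.
move=> xfin; rewrite -lee_fin fineK; last by rewrite ge0_fin_numE ?lp_sum_ge0.
rewrite -sumEFin; apply: le_trans (nneseries_lim_ge n _); first by rewrite big_mkord.
by move=> k _ _; rewrite lee_fin powR_ge0.
Qed.

Lemma lp_of_partial x C : (forall n, \sum_(i < n) `|x i| `^ p <= C) ->
  lp p x /\ fine (lp_sum p x) <= C.
Proof.
move=> hC; have LC : (lp_sum p x <= C%:E)%E.
  apply: lime_le.
    by apply: is_cvg_nneseries => n _ _; rewrite lee_fin powR_ge0.
  by apply: nearW => n; rewrite big_mkord sumEFin lee_fin.
have fin : (lp_sum p x < +oo)%E by rewrite (le_lt_trans LC)// ltry.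
by split=> //; rewrite -lee_fin fineK // ge0_fin_numE ?lp_sum_ge0.
Qed.

End EllP.

(** * The Lorentz norm through finite lists *)

Lemma fresh_nat (s : seq nat) (N : nat) : exists2 k, (N <= k)%N & k \notin s.
Proof.
exists (maxn N (\max_(j <- s) j).+1); first exact: leq_maxl.
apply/negP => /(@leq_bigmax_seq _ s predT id _)/(_ isT) /=.
by move=> /(leq_trans (leq_maxr N (\max_(j <- s) j).+1)); rewrite ltnn.
Qed.

Section Lorentz.
Variable R : realType.
Implicit Types (x y z : seqR R) (s : seq nat).

Lemma c0P x : c0 x <->
  forall e : R, 0 < e -> exists N, forall k, (N <= k)%N -> `|x k| < e.
Proof.
split=> [/cvgr0Pnorm_lt h e /h [N _ hN]|h]; first by exists N.
by apply/cvgr0Pnorm_lt => e /h [N hN]; exists N.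
Qed.

Lemma c0_max_off x s : c0 x ->
  exists k : nat, k \notin s /\ forall j : nat, j \notin s -> `|x j| <= `|x k|.
Proof.
move=> /c0P cx; have [k0 _ k0s] := fresh_nat s 0.
have [[k [ks xk]]|h] := pselect (exists k, k \notin s /\ x k != 0); last first.
  exists k0; split=> // j js; have [->|xj] := eqVneq (x j) 0; first by rewrite normr0.
  by case: h; exists j.
have [|N hN] := cx `|x k|; first by rewrite normr_gt0.
have kN : (k < N)%N by rewrite ltnNge; apply/negP => /hN; rewrite ltxx.
pose P (i : 'I_N) := (i : nat) \notin s.
have Pk : P (Ordinal kN) by [].
case: (@Order.TotalTheory.arg_maxP _ _ _ (Ordinal kN) P (fun i => `|x i|) Pk) => i Pi im.
exists i; split=> // j js; case: (ltnP j N) => jN; first exact: (im (Ordinal jN)).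
by apply: le_trans (im _ Pk); apply/ltW/hN.
Qed.

Lemma c0_greedy x : c0 x -> exists g, greedy (fun k => `|x k|) g.
Proof.
move=> cx; have [f fP] := choice (fun s => c0_max_off s cx).
pose pre n := iter n (fun s => rcons s (f s)) [::].
have preE n : pre n = mkseq (f \o pre) n.
  by elim: n => [//|n IH]; rewrite mkseqS -IH.
have gP n (k : nat) : (k \in pre n) = [exists j : 'I_n, f (pre j) == k].
  rewrite preE; apply/mapP/existsP => [[j]|[j /eqP <-]].
    by rewrite mem_iota add0n => /andP[_ jn] ->; exists (Ordinal jn).
  by exists (nat_of_ord j) => //; rewrite mem_iota add0n ltn_ord.
have lt_neq i j : (i < j)%N -> f (pre i) != f (pre j).
  move=> ij; apply: contraNneq (proj1 (fP (pre j))) => <-.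
  by rewrite gP; apply/existsP; exists (Ordinal ij).
exists (f \o pre); split=> [i j /= e|n k h].
  by case: (ltngtP i j) => // /lt_neq; rewrite e eqxx.
apply: (proj2 (fP _)); rewrite gP; apply/existsPn => j; exact: h.
Qed.

Lemma greedy_drearr x g n : greedy (fun k => `|x k|) g -> drearr x n = `|x (g n)|.
Proof.
move=> [ginj gmax].
have ub s : has_ubound [set `|x k| | k in [set k | k \notin s]].
  by exists `|x (g 0%N)| => _ [k _ <-]; apply: gmax.
rewrite /drearr; set A := [set _ | _ in _]; have lbA : lbound A `|x (g n)|.
  move=> _ [s /= sn <-].
  have [j jn js] : exists2 j, (j <= n)%N & g j \notin s.
    apply: contrapT => h; have : (size (mkseq g n.+1) <= size s)%N.
      apply: uniq_leq_size; first by rewrite mkseq_uniq.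
      move=> k /mapP[j]; rewrite mem_iota add0n ltnS => /andP[_ jn] ->.
      by apply/negPn/negP => js; apply: h; exists j.
    by rewrite size_mkseq sn ltnn.
  apply: (@le_trans _ _ `|x (g j)|).
    apply: gmax => i ij; apply/eqP => /ginj e.
    by move: ij jn; rewrite e; case: ltngtP.
  by apply: ub_le_sup => //; exists (g j).
have Asup : A (sup [set `|x k| | k in [set k | k \notin mkseq g n]]).
  by exists (mkseq g n) => //=; rewrite size_mkseq.
apply/eqP; rewrite eq_le; apply/andP; split; last first.
  apply: lb_le_inf => //.
  by exists (sup [set `|x k| | k in [set k | k \notin mkseq g n]]).
apply: le_trans (_ : sup [set `|x k| | k in [set k | k \notin mkseq g n]] <= _).
  by apply: ge_inf => //; exists `|x (g n)|.
apply: ge_sup => [|_ [k /= kg <-]].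
  exists `|x (g n)|; exists (g n) => //=; apply/negP => /mapP[j].
  by rewrite mem_iota add0n => /andP[_ jn] /ginj e; rewrite e ltnn in jn.
by apply: gmax => j jn; apply: contraNneq kg => <-; apply/mapP; exists j; rewrite // mem_iota.
Qed.

Variables (w : seqR R) (p : R).
Hypothesis p_ge1 : 1 <= p.
Hypothesis w_first : w 0%N = 1.
Hypothesis w_dec : forall n, w n.+1 <= w n.
Hypothesis w_cvg0 : w n @[n --> \oo] --> (0 : R).
Hypothesis w_div : (\sum_(0 <= n <oo) ((w n)%:E))%E = +oo%E.

Lemma p_gt0 : 0 < p. Proof. exact: lt_le_trans p_ge1. Qed.

Lemma w_ge0 n : 0 <= w n.
Proof.
have : nonincreasing_seq w by apply/nonincreasing_seqP.
by move=> /nonincreasing_cvgn_ge /(_ (cvgP _ w_cvg0)) /(_ n); rewrite (cvg_lim _ w_cvg0).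
Qed.

#[local] Hint Resolve p_gt0 w_ge0 : core.

Lemma weight_sum_unbounded C : exists n, C < \sum_(j < n) w j.
Proof.
apply: contrapT => h; have : ((+oo : \bar R) <= C%:E)%E; last by rewrite leye_eq.
rewrite -w_div; apply: lime_le.
  by apply: is_cvg_nneseries => n _ _; rewrite lee_fin w_ge0.
apply: nearW => n; rewrite big_mkord sumEFin lee_fin leNgt; apply/negP => Cn.
by apply: h; exists n.
Qed.

Definition ppow x k := `|x k| `^ p.

Lemma ppow_ge0 x k : 0 <= ppow x k. Proof. exact: powR_ge0. Qed.

Lemma ler_ppow x y k l : (ppow x k <= ppow y l) = (`|x k| <= `|y l|).
Proof.
rewrite /ppow; apply/idP/idP => [|h]; last first.
  by apply: ge0_ler_powR => //; rewrite ?nnegrE// ltW ?p_gt0.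
apply: contraTT; rewrite -!ltNge => h.
by apply: gt0_ltr_powR => //; rewrite ?p_gt0// nnegrE.
Qed.

Lemma lorentz_sum_greedy x g : greedy (fun k => `|x k|) g ->
  lorentz_sum w p x = (\sum_(0 <= n <oo) ((w n * ppow x (g n))%:E))%E.
Proof. by move=> gr; apply: eq_eseriesr => n _; rewrite (greedy_drearr _ gr). Qed.

Lemma lorentz_sum_ge0 x : (0 <= lorentz_sum w p x)%E.
Proof.
by apply: nneseries_ge0 => n _ _; rewrite lee_fin mulr_ge0 ?w_ge0 ?powR_ge0.
Qed.

(* The p-th power of the norm. With it, (u + v)^p <= 2^p (u^p + v^p) replaces
   Minkowski's inequality throughout. *)
Definition pnorm x := fine (lorentz_sum w p x).

Lemma pnorm_ge0 x : 0 <= pnorm x.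
Proof. by rewrite fine_ge0 ?lorentz_sum_ge0. Qed.

#[local] Hint Resolve pnorm_ge0 : core.

Lemma wsum_le_pnorm x s : dwp w p x -> uniq s -> wsum w (ppow x) 0 s <= pnorm x.
Proof.
move=> [cx xfin] us; have [g gr] := c0_greedy cx.
have gr' : greedy (ppow x) g by case: gr => gi gm; split=> // n k /gm; rewrite ler_ppow.
apply: le_trans (greedy_wsum w_ge0 w_dec gr' us) _.
rewrite -lee_fin /pnorm fineK; last by rewrite ge0_fin_numE ?lorentz_sum_ge0.
rewrite (lorentz_sum_greedy gr) wsum_mkseq -sumEFin.
apply: le_trans (nneseries_lim_ge (size s) _).
  by rewrite big_mkord.
by move=> n _ _; rewrite lee_fin mulr_ge0 ?w_ge0 ?ppow_ge0.
Qed.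

Lemma dwp_of_wsum x C : (forall s, uniq s -> wsum w (ppow x) 0 s <= C) ->
  dwp w p x /\ pnorm x <= C.
Proof.
move=> hC; have cx : c0 x.
  apply/c0P => e e0; apply: contrapT => h.
  have {}h N : exists2 k, (N <= k)%N & e <= `|x k|.
    apply: contrapT => h'; apply: h; exists N => k Nk; rewrite ltNge.
    by apply/negP => ek; apply: h'; exists k.
  have large n : exists s, [/\ uniq s, size s = n & forall k, k \in s -> e <= `|x k|].
    elim: n => [|n [s [us sn se]]]; first by exists [::].
    have [k /= sk ek] := h (\max_(j <- s) j).+1.
    exists (k :: s); split=> /=; rewrite ?sn ?us ?andbT//.
      apply/negP => /(@leq_bigmax_seq _ s predT id _)/(_ isT) /= ks.
      by move: (leq_trans sk ks); rewrite ltnn.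
    by move=> j; rewrite inE => /predU1P[->//|/se].
  have ep : 0 < e `^ p by rewrite powR_gt0.
  have [n] := weight_sum_unbounded (C / e `^ p).
  have [s [us <- se]] := large n.
  rewrite ltr_pdivrMr// ltNge mulrC => /negP; apply; apply: le_trans (hC s us).
  apply: wsum_lower; rewrite ?powR_ge0//.
  by move=> k /se ek; apply: ge0_ler_powR; rewrite ?nnegrE// ltW ?p_gt0.
have [g gr] := c0_greedy cx.
have LC : (lorentz_sum w p x <= C%:E)%E.
  rewrite (lorentz_sum_greedy gr); apply: lime_le.
    by apply: is_cvg_nneseries => n _ _; rewrite lee_fin mulr_ge0 ?w_ge0 ?ppow_ge0.
  apply: nearW => n; rewrite big_mkord sumEFin lee_fin -wsum_mkseq; apply: hC.
  by rewrite mkseq_uniq; case: gr.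
have fin : lorentz_sum w p x \is a fin_num.
  by rewrite ge0_fin_numE ?lorentz_sum_ge0// (le_lt_trans LC)// ltry.
split; first by split=> //; rewrite (le_lt_trans LC)// ltry.
by rewrite -lee_fin /pnorm fineK.
Qed.

Notation D := (dwp w p).
Notation L := pnorm.

Lemma ppowZ c x k : ppow (fun k => c * x k) k = `|c| `^ p * ppow x k.
Proof. by rewrite /ppow normrM powRM. Qed.

Lemma pnormZ c x : D x -> D (fun k => c * x k) /\ L (fun k => c * x k) <= `|c| `^ p * L x.
Proof.
move=> Dx; apply: dwp_of_wsum => s us.
rewrite (@eq_wsum _ _ _ (fun k => `|c| `^ p * ppow x k)); last by move=> k _; rewrite ppowZ.
by rewrite wsumZ ler_wpM2l ?powR_ge0 ?wsum_le_pnorm.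
Qed.

Lemma ppow_le_pnorm x k : D x -> ppow x k <= L x.
Proof.
by move=> Dx; have := @wsum_le_pnorm _ [:: k] Dx isT; rewrite /= w_first mul1r addr0.
Qed.

Lemma pnorm_approx x e : 0 < e -> exists2 s, uniq s & L x - e < wsum w (ppow x) 0 s.
Proof.
move=> e0; apply: contrapT => h.
have [|_] := @dwp_of_wsum x (L x - e); last by rewrite lerBrDr gerDl leNgt e0.
by move=> s us; rewrite leNgt; apply/negP => hs; apply: h; exists s.
Qed.

Definition tail N x k := if (N <= k)%N then x k else 0.

Lemma tail_small x e : D x -> 0 < e ->
  exists N0, forall N, (N0 <= N)%N -> D (tail N x) /\ L (tail N x) <= e.
Proof.
move=> Dx e0; have e2 : 0 < e / 2 by rewrite divr_gt0.
have [s0 us0 hs0] := @pnorm_approx x _ e2.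
set m := size s0 in hs0 *; set W := \sum_(j < m) w j.
have W0 : 0 <= W by apply: sumr_ge0.
have [N1 hN1] : exists N1, forall k, (N1 <= k)%N -> ppow x k <= e / 2 / (W + 1).
  have d0 : 0 < e / 2 / (W + 1) by rewrite !divr_gt0// ltr_wpDl.
  have [|N1 hN1] := (proj1 (c0P x) (proj1 Dx)) ((e / 2 / (W + 1)) `^ p^-1).
    by rewrite powR_gt0.
  exists N1 => k /hN1 /ltW xk; rewrite -[leRHS](powR_rootK p_ge1) ?(ltW d0)//.
  by apply: ge0_ler_powR; rewrite ?nnegrE ?powR_ge0// ltW.
exists (maxn N1 (\max_(j <- s0) j).+1) => N; rewrite geq_max => /andP[N1N s0N].
apply: dwp_of_wsum => s us; set y := tail N x.
have y0 k : (k < N)%N -> ppow y k = 0.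
  by rewrite /ppow /y /tail ltnNge => /negbTE ->; rewrite normr0 powR0 ?gt_eqF.
have yx k : ppow y k <= ppow x k.
  by rewrite ler_ppow// /y /tail; case: ifP; rewrite ?normr0.
pose t := [seq k <- s | (N <= k)%N].
have ut : uniq t by rewrite filter_uniq.
apply: le_trans (wsum_filter w_dec (P := fun k => (N <= k)%N) 0 (ppow_ge0 y) _) _.
  by move=> k _; rewrite -ltnNge => /y0.
rewrite -/t -(cat_take_drop m t) wsum_cat add0n [e]splitr; apply: lerD.
  apply: (@le_trans _ _ (e / 2 / (W + 1) * \sum_(j < size (take m t)) w j)).
    apply: wsum_upper => //; first by rewrite !divr_ge0 ?addr_ge0// ltW.
    move=> k /mem_take; rewrite mem_filter => /andP[Nk _].
    by rewrite (le_trans (yx _))// hN1// (leq_trans N1N).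
  rewrite -mulrA ler_piMr ?divr_ge0 ?(ltW e0)//.
  rewrite mulrC ler_pdivrMr ?ltr_wpDl// mul1r.
  apply: le_trans (_ : W <= _); last by rewrite lerDl.
  rewrite /W -!(big_mkord predT w) (@big_cat_nat _ _ _ (size (take m t)) 0 m)//=.
    by rewrite lerDl sumr_ge0.
  by rewrite size_take_min geq_minl.
have [mt|tm] := leqP m (size t); last first.
  by rewrite drop_oversize ?divr_ge0 ?(ltW e0)// ltnW.
rewrite size_takel//.
have us0t : uniq (s0 ++ drop m t).
  rewrite cat_uniq us0 drop_uniq// andbT; apply/hasPn => k /mem_drop.
  rewrite mem_filter => /andP[Nk _]; apply/negP => /(@leq_bigmax_seq _ s0 predT id _)/(_ isT) /= ks.
  by have := leq_trans s0N Nk; rewrite ltnNge ks.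
have := wsum_le_pnorm Dx us0t; rewrite wsum_cat add0n -/m => h.
apply: (@le_trans _ _ (wsum w (ppow x) m (drop m t))); first exact: ler_wsum.
by move: h hs0; set A := wsum _ _ 0 s0; set B := wsum _ _ m _; move=> h hs0; lra.
Qed.

Lemma bounded_dwp T : bounded_op D (dwp_norm w p) D (dwp_norm w p) T ->
  exists2 C, 0 < C & forall x, D x -> L (T x) <= C * L x.
Proof.
move=> [_ _ [C hC]]; exists (`|C| `^ p + 1); first by rewrite ltr_wpDl ?powR_ge0.
move=> x /hC h; apply: (@le_trans _ _ (`|C| `^ p * L x)).
  by apply: powR_root_le.
by rewrite ler_wpM2r// lerDl.
Qed.

Lemma iso_on_dwp T M : iso_on (dwp_norm w p) T M ->
  exists2 c, 0 < c & forall x, M x -> c * L x <= L (T x).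
Proof.
move=> [c [c0 hc]]; exists (c `^ p); first by rewrite powR_gt0.
move=> x /hc; rewrite mulrC -ler_pdivlMr// mulrC => h.
have := powR_root_le p_ge1 (pnorm_ge0 x) (pnorm_ge0 (T x)) h.
rewrite ger0_norm ?invr_ge0 ?(ltW c0)// => {}h.
rewrite mulrC -ler_pdivlMr ?powR_gt0// mulrC; apply: le_trans h _.
by rewrite -powR_inv1 ?(ltW c0)// powRAC powR_inv1 ?powR_ge0.
Qed.

Lemma pnormZ_eq c x : c != 0 -> D x -> L (fun k => c * x k) = `|c| `^ p * L x.
Proof.
move=> c0 Dx; have [Dcx le1] := pnormZ c Dx; apply/eqP; rewrite eq_le le1 /=.
have [_] := pnormZ c^-1 Dcx.
rewrite (_ : (fun k => c^-1 * (c * x k)) = x); last by apply/funext => k; rewrite mulKf.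
have cp : `|c| `^ p != 0 by rewrite powR_eq0 normr_eq0 (negbTE c0).
have -> : `|c^-1| `^ p = (`|c| `^ p)^-1.
  apply: (mulIf cp); rewrite mulVf// -powRM// -normrM mulVf// normr1.
  by rewrite powR1.
by rewrite ler_pdivlMl// powR_gt0// normr_gt0.
Qed.

Lemma pnorm_scale x : 0 < L x -> exists2 c, 0 < c & `|c| `^ p * L x = 1.
Proof.
move=> L0; exists ((L x)^-1 `^ p^-1); first by rewrite powR_gt0 ?invr_gt0.
rewrite ger0_norm ?powR_ge0// powR_rootK// ?mulVf ?gt_eqF//.
by rewrite invr_ge0 ltW.
Qed.

Lemma weight_sum_bounded N e : 0 < e ->
  exists2 d, 0 < d & d `^ p * \sum_(j < N) w j <= e.
Proof.
move=> e0; set W := \sum_(_ < _) _; have W0 : 0 <= W by apply: sumr_ge0.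
have f0 : 0 < e / (W + 1) by rewrite divr_gt0// ltr_wpDl.
exists ((e / (W + 1)) `^ p^-1); first by rewrite powR_gt0.
rewrite powR_rootK ?(ltW f0)// -mulrA ler_piMr ?(ltW e0)//.
by rewrite mulrC ler_pdivrMr ?ltr_wpDl// mul1r lerDl.
Qed.

(** * Flat almost disjoint vectors *)

Section Subspace.
Variables (T : seqR R -> seqR R) (M : set (seqR R)) (C c : R).
Hypothesis C_gt0 : 0 < C.
Hypothesis c_gt0 : 0 < c.
Hypothesis T_dwp : forall x, D x -> D (T x).
Hypothesis T_lin : forall (a b : R) x y, D x -> D y ->
  T (fun k => a * x k + b * y k) = (fun k => a * T x k + b * T y k).
Hypothesis T_bounded : forall x, D x -> L (T x) <= C * L x.
Hypothesis MD : M `<=` D.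
Hypothesis M_lin : lin_subspace M.
Hypothesis M_inf : infinite_dim M.
Hypothesis T_iso : forall x, M x -> c * L x <= L (T x).

Lemma lin0 : T (fun _ => 0) = (fun _ => 0).
Proof.
have D0 := MD (proj1 M_lin); have := T_lin 0 0 D0 D0.
rewrite (_ : (fun k : nat => 0 * 0 + 0 * 0 : R) = (fun _ => 0)); last by apply/funext => k; ring.
by move=> ->; apply/funext => k; ring.
Qed.

Lemma linZ (a : R) x : D x -> T (fun k => a * x k) = (fun k => a * T x k).
Proof.
move=> Dx; have := T_lin a 0 Dx Dx.
rewrite (_ : (fun k : nat => a * x k + 0 * x k) = (fun k => a * x k)); last first.
  by apply/funext => k; ring.
by move=> ->; apply/funext => k; ring.
Qed.

Lemma subspaceZ (a : R) x : M x -> M (fun k => a * x k).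
Proof.
move=> Mx; have := proj2 M_lin a 0 _ _ Mx Mx.
by congr M; apply/funext => k; ring.
Qed.

Lemma subspace_comb n (v : 'I_n -> seqR R) (a : 'I_n -> R) : (forall i, M (v i)) ->
  M (fun k => \sum_(i < n) a i * v i k) /\
  T (fun k => \sum_(i < n) a i * v i k) = (fun k => \sum_(i < n) a i * T (v i) k).
Proof.
elim: n v a => [|n IH] v a Mv.
  rewrite (_ : (fun k => _) = fun _ => 0); last by apply/funext => k; rewrite big_ord0.
  split; first exact: (proj1 M_lin).
  by rewrite lin0; apply/funext => k; rewrite big_ord0.
have [M1 T1] := IH (fun i => v (lift ord0 i)) (fun i => a (lift ord0 i)) (fun i => Mv _).
have E : (fun k => \sum_(i < n.+1) a i * v i k) =
    (fun k => a ord0 * v ord0 k + 1 * \sum_(i < n) a (lift ord0 i) * v (lift ord0 i) k).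
  by apply/funext => k; rewrite big_ord_recl mul1r.
rewrite E; split; first exact: (proj2 M_lin).
rewrite T_lin ?T1; [|exact: MD..].
by apply/funext => k; rewrite big_ord_recl mul1r.
Qed.

Definition heads_vanish N x := forall k, (k < N)%N -> x k = 0 /\ T x k = 0.

(* The heads impose 2N linear conditions, met by some combination of 2N+1
   independent vectors. *)
Lemma exists_heads_vanish N : exists x, [/\ M x, L x = 1 & heads_vanish N x].
Proof.
suff [x [Mx hx [k xk]]] : exists x, [/\ M x, heads_vanish N x & exists k, x k != 0].
  have L0 : 0 < L x.
    apply: lt_le_trans (ppow_le_pnorm k (MD Mx)).
    by rewrite /ppow powR_gt0// normr_gt0.
  have [a a0 aL] := pnorm_scale L0; exists (fun k => a * x k).
  split; [exact: subspaceZ | by rewrite pnormZ_eq ?gt_eqF//; exact: MD |].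
  move=> j /hx [xj Txj]; rewrite linZ ?xj ?Txj ?mulr0//; exact: MD.
have [v [Mv indep]] := M_inf (N + N).+1.
pose A := \matrix_(i < (N + N).+1, j < N + N)
  match fintype.split j with inl j1 => v i j1 | inr j2 => T (v i) j2 end.
have : kermx A != 0.
  by rewrite kermx_eq0 /row_free neq_ltn ltnS rank_leq_col.
move=> /rowV0Pn [u /sub_kermxP uA u0]; exists (fun k => \sum_i u 0 i * v i k).
have [MX TX] := subspace_comb (fun i => u 0 i) Mv; split=> //.
  move=> k kN; rewrite TX; split.
    have := congr1 (fun B : 'rV_(N + N) => B 0 (lshift N (Ordinal kN))) uA.
    rewrite !mxE => e; rewrite -[RHS]e.
    apply: eq_bigr => i _; rewrite mxE (_ : fintype.split _ = inl (Ordinal kN))//.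
    exact: (unsplitK (inl _)).
  have := congr1 (fun B : 'rV_(N + N) => B 0 (rshift N (Ordinal kN))) uA.
  rewrite !mxE => e; rewrite -[RHS]e.
  apply: eq_bigr => i _; rewrite mxE (_ : fintype.split _ = inr (Ordinal kN))//.
  exact: (unsplitK (inr _)).
apply: contrapT => h; move/eqP: u0; apply; apply/rowP => i; rewrite mxE.
apply: (indep (fun i => u 0 i)) => k; apply/eqP/negPn/negP => hk.
by apply: h; exists k.
Qed.

(* Otherwise every normalized x in M with vanishing heads satisfies
   |T x k| > d for some k. Adding n such vectors with almost disjoint images
   gives X with sup |T X| bounded, hence pnorm X bounded, while
   pnorm (T X) >= (d/2)^p (w_0 + ... + w_(n-1)) is unbounded. *)
Lemma exists_flat N d : 0 < d ->
  exists x, [/\ M x, L x = 1, heads_vanish N x & forall k, `|T x k| <= d].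
Proof.
move=> d0; apply: contrapT => h.
have {}h x : M x -> L x = 1 -> heads_vanish N x -> exists k, d < `|T x k|.
  move=> Mx Lx hx; apply: contrapT => h'; apply: h; exists x; split=> // k.
  by rewrite leNgt; apply/negP => hk; apply: h'; exists k.
pose B := C `^ p^-1 + 1.
have sup_bound x k : M x -> L x = 1 -> `|T x k| <= B - 1.
  move=> Mx Lx; rewrite /B addrK; have := T_bounded (MD Mx); rewrite Lx mulr1 => h1.
  have := le_trans (ppow_le_pnorm k (T_dwp (MD Mx))) h1.
  rewrite -{1}[C](powR_rootK p_ge1) ?(ltW C_gt0)// => h2.
  rewrite leNgt; apply/negP => h3; move: h2; rewrite leNgt => /negP; apply.
  by apply: gt0_ltr_powR; rewrite ?p_gt0// nnegrE ?powR_ge0.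
have grow n : exists X s, [/\ M X, heads_vanish N X, uniq s /\ size s = n,
    forall k, k \in s -> d / 2 <= `|T X k| & forall k, `|T X k| <= B].
  elim: n => [|n [X [s [MX hX [us sn] Xs XB]]]].
    exists (fun _ => 0), [::]; split=> //; first exact: (proj1 M_lin).
      by move=> k _; rewrite lin0.
    by move=> k; rewrite lin0 normr0 addr_ge0 ?powR_ge0.
  have e0 : 0 < Num.min (d / 2) 1 by rewrite lt_min ltr01 divr_gt0.
  have [N1 hN1] := proj1 (c0P (T X)) (proj1 (T_dwp (MD MX))) _ e0.
  pose N2 := maxn N (maxn N1 (\max_(j <- s) j).+1).
  have [NN2 N12] : (N <= N2)%N /\ (N1 <= N2)%N.
    by rewrite !leq_max !leqnn orbT.
  have sN2 j : j \in s -> (j < N2)%N.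
    move=> js; rewrite !leq_max ltnS; apply/orP; right; apply/orP; right.
    exact: (@leq_bigmax_seq _ s predT id).
  have [x [Mx Lx hx]] := exists_heads_vanish N2.
  have hx' : heads_vanish N x by move=> k kN; apply: hx; apply: leq_trans NN2.
  have [k1 xk1] := h x Mx Lx hx'.
  have k1N : (N2 <= k1)%N.
    rewrite leqNgt; apply/negP => /hx [_ e].
    by move: xk1; rewrite e normr0 ltNge (ltW d0).
  have TXx : T (fun k => 1 * X k + 1 * x k) = (fun k => T X k + T x k).
    by rewrite T_lin ?mul1r; [apply/funext => k; rewrite !mul1r | exact: MD..].
  have small k : (N2 <= k)%N -> `|T X k| < d / 2 /\ `|T X k| < 1.
    by move=> /(leq_trans N12)/hN1; rewrite lt_min => /andP.
  exists (fun k => 1 * X k + 1 * x k), (k1 :: s); rewrite TXx; split.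
  - exact: (proj2 M_lin).
  - move=> k kN; rewrite TXx; have [-> ->] := hX _ kN; have [-> ->] := hx' _ kN.
    by rewrite !mulr0 addr0.
  - rewrite /= sn us andbT; split=> //; apply/negP => /sN2.
    by rewrite ltnNge k1N.
  - move=> k; rewrite inE => /predU1P[->|ks].
      have [sm _] := small _ k1N; have := lerB_normD (T x k1) (T X k1).
      by rewrite [T x _ + _]addrC => h1; lra.
    by have [_ ->] := hx _ (sN2 _ ks); rewrite addr0 Xs.
  - move=> k; case: (ltnP k N2) => kN; first by have [_ ->] := hx _ kN; rewrite addr0.
    have [_ sm] := small _ kN; have := sup_bound x k Mx Lx.
    by have := ler_normD (T X k) (T x k) => h1 h2; lra.
have dp : 0 < d `^ p by rewrite powR_gt0.
have dp2 : 0 < (d / 2) `^ p by rewrite powR_gt0// divr_gt0.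
have [n hn] := weight_sum_unbounded (C * (B `^ p / d `^ p) / (d / 2) `^ p).
have [X [s [MX hX [us sn] Xs XB]]] := grow n.
move: hn; rewrite ltr_pdivrMr// [ltRHS]mulrC ltNge => /negP; apply; rewrite -sn.
have low : (d / 2) `^ p * \sum_(j < size s) w j <= L (T X).
  apply: le_trans (wsum_le_pnorm (T_dwp (MD MX)) us).
  apply: wsum_lower; rewrite ?powR_ge0// => k /Xs Xk.
  by apply: ge0_ler_powR; rewrite ?nnegrE ?(ltW p_gt0)// ltW// divr_gt0.
apply: le_trans low (le_trans (T_bounded (MD MX)) _); rewrite ler_pM2l//.
have [L0|] := leP (L X) 0; first by rewrite (le_trans L0)// divr_ge0 ?powR_ge0.
move=> L0; have [a a0 aL] := pnorm_scale L0.
have [||j jN|k] := h (fun k => a * X k).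
- exact: subspaceZ.
- by rewrite pnormZ_eq ?gt_eqF//; exact: MD.
- by rewrite linZ; [have [-> ->] := hX _ jN; rewrite !mulr0|exact: MD].
rewrite linZ; last exact: MD.
rewrite normrM => dk; rewrite ler_pdivlMr//.
have ap : 0 < `|a| `^ p by rewrite powR_gt0// normr_gt0 gt_eqF.
rewrite -(ler_pM2l ap) mulrA aL mul1r -powRM//; last by rewrite addr_ge0 ?powR_ge0.
have B0 : 0 <= B by rewrite addr_ge0 ?powR_ge0.
apply: ge0_ler_powR; rewrite ?nnegrE ?mulr_ge0 ?(ltW p_gt0) ?(ltW d0)//.
by apply: le_trans (ltW dk) _; rewrite ler_wpM2l.
Qed.

Definition bump_spec N e (xrN : seqR R * seq nat * nat) :=
  let: (x, r, N') := xrN in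
  [/\ M x /\ L x = 1, heads_vanish N x,
      [/\ uniq r, forall k, k \in r -> (N <= k < N')%N & (N < N')%N],
      c / 2 <= wsum w (ppow (T x)) N r &
      (D (tail N' x) /\ L (tail N' x) <= e) /\
      (D (tail N' (T x)) /\ L (tail N' (T x)) <= e)].

Lemma exists_bump N e : 0 < e -> exists b, bump_spec N e b.
Proof.
move=> e0; have c4 : 0 < c / 4 by rewrite divr_gt0.
have [d d0 dN] := weight_sum_bounded N c4.
have [x [Mx Lx hx Txd]] := exists_flat N d0.
have DTx := T_dwp (MD Mx).
have [s us hs] := @pnorm_approx (T x) _ c4.
have Tc : c <= L (T x) by have := T_iso Mx; rewrite Lx mulr1.
pose r := [seq k <- drop N s | (N <= k)%N].
have [N1 hN1] := tail_small (MD Mx) e0; have [N2 hN2] := tail_small DTx e0.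
pose N' := maxn (maxn N1 N2) (maxn N (\max_(j <- r) j)).+1.
have [N1N N2N] : (N1 <= N')%N /\ (N2 <= N')%N by rewrite !leq_max !leqnn ?orbT.
exists (x, r, N'); split; first by split; [exact: Mx | exact: Lx].
- exact: hx.
- split; first by rewrite filter_uniq// drop_uniq.
    move=> k kr; apply/andP; split; first by move: kr; rewrite mem_filter => /andP[].
    apply: leq_trans (leq_maxr _ _); rewrite ltnS leq_max; apply/orP; right.
    exact: (@leq_bigmax_seq _ r predT id).
  by apply: leq_trans (leq_maxr _ _); rewrite ltnS leq_maxl.
2: by split; [exact: hN1 | exact: hN2].
apply: le_trans (wsum_filter w_dec (P := fun k => (N <= k)%N) N (ppow_ge0 (T x)) _); last first.
  by move=> k _; rewrite -ltnNge => /hx [_ e1]; rewrite /ppow e1 normr0 powR0 ?gt_eqF.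
move: hs; rewrite -{1}(cat_take_drop N s) wsum_cat add0n.
have up : wsum w (ppow (T x)) 0 (take N s) <= c / 4.
  apply: le_trans dN; apply: (@le_trans _ _ (d `^ p * \sum_(j < size (take N s)) w j)).
    apply: wsum_upper; rewrite ?powR_ge0// => k _.
    by apply: ge0_ler_powR; rewrite ?nnegrE ?(ltW p_gt0) ?(ltW d0).
  rewrite ler_wpM2l ?powR_ge0// -!(big_mkord predT w).
  rewrite (@big_cat_nat _ _ _ (size (take N s)) 0 N)//=; last by rewrite size_take_min geq_minl.
  by rewrite lerDl sumr_ge0.
have [Ns|sN] := leqP N (size s).
  rewrite (size_takel Ns); move: up Tc.
  by move: (wsum w _ 0 _) (wsum w _ N _) (L _) => A B l; clear N1N N2N Ns; lra.
rewrite (drop_oversize (ltnW sN)) /= addr0; move: up Tc c4.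
by move: (wsum w _ 0 _) (L _) => A l; clear N1N N2N sN; lra.
Qed.
End Subspace.

(** * Factoring the identity of l_p through T *)

Notation K := (2 `^ p).

Lemma pnorm_comb n (a : nat -> R) (v : nat -> seqR R) : (forall i, D (v i)) ->
  D (fun k => \sum_(i < n) a i * v i k) /\
  L (fun k => \sum_(i < n) a i * v i k) <=
    \sum_(i < n) K ^+ i.+1 * (`|a i| `^ p * L (v i)).
Proof.
move=> Dv; apply: dwp_of_wsum => s us.
apply: (@le_trans _ _ (wsum w
    (fun k => \sum_(i < n) K ^+ i.+1 * (`|a i| `^ p * ppow (v i) k)) 0 s)).
  apply: ler_wsum => // k _; rewrite /ppow (le_trans (powR_norm_sum p_ge1 _))//.
  by apply: ler_sum => i _; rewrite normrM powRM.
rewrite wsum_sum; apply: ler_sum => i _; rewrite !wsumZ.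
by rewrite !ler_wpM2l ?exprn_ge0 ?powR_ge0// wsum_le_pnorm.
Qed.

Section BumpSequence.
Variables (T : seqR R -> seqR R) (C d : R).
Hypothesis C_gt0 : 0 < C.
Hypothesis d_gt0 : 0 < d.
Hypothesis T_dwp : forall x, D x -> D (T x).
Hypothesis T_lin : forall (a b : R) x y, D x -> D y ->
  T (fun k => a * x k + b * y k) = (fun k => a * T x k + b * T y k).
Hypothesis T_bounded : forall x, D x -> L (T x) <= C * L x.
Variables (eta : R) (x : nat -> seqR R) (r : nat -> seq nat) (N : nat -> nat).
Hypothesis eta_le1 : eta <= 1.
Hypothesis eta_small : K * ((C + 1) `^ p * eta) <= d `^ p / 2.
Let y i := T (x i).
Hypothesis Dx : forall i, D (x i).
Hypothesis Lx : forall i, L (x i) = 1.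
Hypothesis heads : forall i, heads_vanish T (N i) (x i).
Hypothesis r_uniq : forall i, uniq (r i).
Hypothesis r_range : forall i k, k \in r i -> (N i <= k < N i.+1)%N.
Hypothesis N_incr : forall i, (N i < N i.+1)%N.
Hypothesis r_mass : forall i, d <= wsum w (ppow (y i)) (N i) (r i).
Hypothesis tail_x : forall i, D (tail (N i.+1) (x i)) /\
  L (tail (N i.+1) (x i)) <= eta / K ^+ i.+1.
Hypothesis tail_y : forall i, D (tail (N i.+1) (y i)) /\
  L (tail (N i.+1) (y i)) <= eta / K ^+ i.+1.

Let K_gt0 : 0 < K :> R. Proof. by rewrite powR_gt0. Qed.

Lemma N_mono i j : (i <= j)%N -> (N i <= N j)%N.
Proof.
move=> /subnK <-; elim: (j - i)%N => [//|k IH].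
by rewrite addSn (leq_trans IH)// ltnW.
Qed.

Lemma N_ge i : (i <= N i)%N.
Proof. by elim: i => [//|i IH]; exact: leq_ltn_trans IH (N_incr i). Qed.

Definition synth (u : nat -> seqR R) (a : seqR R) : seqR R :=
  fun k => \sum_(i < k.+1) a i * u i k.

Lemma synthE (u : nat -> seqR R) a n k : (forall i j, (j < N i)%N -> u i j = 0) ->
  (k < n)%N -> synth u a k = \sum_(i < n) a i * u i k.
Proof.
move=> u0 kn; rewrite /synth -(subnKC kn) big_split_ord /= [X in _ = _ + X]big1 ?addr0//.
by move=> i _; rewrite u0 ?mulr0// (leq_trans _ (N_ge _))//= addSn ltnS leq_addr.
Qed.

Lemma synth_lin u (a b : R) e f :
  synth u (fun k => a * e k + b * f k) = fun k => a * synth u e k + b * synth u f k.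
Proof.
apply/funext => k; rewrite /synth !mulr_sumr -big_split /=.
by apply: eq_bigr => i _; ring.
Qed.

(* Each x_i is a block u_i plus a tail v_i. The blocks satisfy an upper
   p-estimate with constant 1, since w is non-increasing; the tails are small
   enough to absorb the factors (2^p)^(i+1) of pnorm_comb. *)
Lemma synth_bounded (a : seqR R) A : (forall n, \sum_(i < n) `|a i| `^ p <= A) ->
  D (synth x a) /\ L (synth x a) <= K * (2 * A).
Proof.
move=> aA; apply: dwp_of_wsum => s us; pose n := (\max_(k <- s) k).+1.
pose u i k := if (k < N i.+1)%N then x i k else 0.
pose v i := tail (N i.+1) (x i).
have uvx i k : x i k = u i k + v i k.
  by rewrite /u /v /tail ltnNge; case: (N _ <= k)%N; rewrite ?addr0 ?add0r.
have u_disj k : ppow (fun k => \sum_(i < n) a i * u i k) k <=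
    \sum_(i < n) `|a i| `^ p * ppow (x i) k.
  have [[i ui]|none] := pselect (exists i : 'I_n, u i k != 0); last first.
    rewrite /ppow big1 ?normr0 ?powR0 ?gt_eqF//.
      by apply: sumr_ge0 => i _; rewrite mulr_ge0 ?powR_ge0.
    move=> i _; have [->|ui] := eqVneq (u i k) 0; first by rewrite mulr0.
    by case: none; exists i.
  have range j : u j k != 0 -> (N j <= k < N j.+1)%N.
    rewrite /u; case: ifP => [kN xj|]; last by rewrite eqxx.
    rewrite andbT leqNgt; apply/negP => /(heads (i := j))[xj0 _].
    by rewrite xj0 eqxx in xj.
  have only j : (j : nat) != i -> u j k = 0.
    move=> ji; apply/eqP/negPn/negP => /range /andP[jk kj].
    have /andP[ik ki] := range _ ui; case: (ltngtP j i) ji => // ji _.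
      by move: (leq_trans kj (leq_trans (N_mono ji) ik)); rewrite ltnn.
    by move: (leq_trans ki (leq_trans (N_mono ji) jk)); rewrite ltnn.
  rewrite {1}/ppow (bigD1 i)//= [X in `|_ + X|]big1 ?addr0; last first.
    by move=> j ji; rewrite only ?mulr0.
  rewrite (bigD1 i)//= normrM powRM// -[leLHS]addr0 lerD//.
    rewrite ler_wpM2l ?powR_ge0// /ppow /u; case: ifP => //.
    by rewrite normr0 powR0 ?powR_ge0 ?gt_eqF.
  by apply: sumr_ge0 => j _; rewrite mulr_ge0 ?powR_ge0.
have Dv i : D (v i) by have [] := tail_x i.
apply: (@le_trans _ _ (K * (wsum w (fun k => \sum_(i < n) `|a i| `^ p * ppow (x i) k) 0 s
    + wsum w (ppow (fun k => \sum_(i < n) a i * v i k)) 0 s))).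
  rewrite -wsumD -wsumZ; apply: ler_wsum => // k ks.
  rewrite {1}/ppow (@synthE _ _ n); last 2 first.
  - by move=> i j /(heads (i := i))[].
  - by rewrite ltnS; exact: (@leq_bigmax_seq _ s predT id).
  rewrite (eq_bigr (fun i : 'I_n => a i * u i k + a i * v i k)); last first.
    by move=> i _; rewrite uvx mulrDr.
  by rewrite big_split /= (le_trans (powR_normD p_ge1 _ _))// ler_wpM2l ?(ltW K_gt0)// lerD2r u_disj.
rewrite ler_wpM2l ?(ltW K_gt0)// mulr2n mulrDl mul1r; apply: lerD.
  apply: le_trans (aA n); rewrite wsum_sum; apply: ler_sum => i _.
  by rewrite wsumZ ler_piMr ?powR_ge0// -(Lx i) wsum_le_pnorm.
have [Dh Lh] := pnorm_comb n a Dv.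
apply: le_trans (wsum_le_pnorm Dh us) (le_trans Lh (le_trans _ (aA n))).
apply: ler_sum => i _; rewrite mulrCA ler_piMr ?powR_ge0//.
rewrite mulrC -ler_pdivlMr ?exprn_gt0// (le_trans (proj2 (tail_x i)))//.
by rewrite ler_wpM2r// invr_ge0 exprn_ge0// ltW.
Qed.

Lemma lp_tail_small a e : lp p a -> 0 < e ->
  exists N0, forall n m, (N0 <= n)%N -> \sum_(i < m) `|tail n a i| `^ p <= e.
Proof.
move=> la e0; set A := fine (lp_sum p a).
have [N0 hN0] : exists N0, A - e < \sum_(i < N0) `|a i| `^ p.
  apply: contrapT => h; have [|_] := @lp_of_partial _ p a (A - e).
    by move=> n; rewrite leNgt; apply/negP => hn; apply: h; exists n.
  by rewrite -/A lerBrDr gerDl leNgt e0.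
exists N0 => n m Nn; pose M := (n + m)%N.
have : \sum_(i < M) `|a i| `^ p <= A by exact: partial_le_lp.
have tle i : 0 <= `|tail n a i| `^ p by exact: powR_ge0.
suff : \sum_(i < N0) `|a i| `^ p + \sum_(i < m) `|tail n a i| `^ p <= \sum_(i < M) `|a i| `^ p.
  by move: hN0; move: (\sum_(_ < N0) _) (\sum_(_ < m) _) (\sum_(_ < M) _) => q1 q2 q3; clear Nn; lra.
apply: (@le_trans _ _ (\sum_(i < N0) `|a i| `^ p + \sum_(i < M) `|tail n a i| `^ p)).
  by rewrite lerD2l /M addnC big_split_ord /= lerDl sumr_ge0.
have N0M : (N0 <= M)%N by rewrite (leq_trans Nn)// leq_addr.
rewrite -!(big_mkord predT (fun i => `|tail n a i| `^ p)).
rewrite -!(big_mkord predT (fun i => `|a i| `^ p)) ![\sum_(0 <= i < M) _](@big_cat_nat _ _ _ N0)//=.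
rewrite lerD2l big_nat big1 ?add0r.
  by apply: ler_sum => i _; rewrite /tail; case: ifP; rewrite // normr0 powR0 ?gt_eqF// powR_ge0.
move=> i /andP[_ iN0]; rewrite /tail leqNgt (leq_trans iN0)//= normr0 powR0// gt_eqF//.
Qed.


Lemma dwp_lin : lin_subspace D.
Proof.
split=> [|a b z1 z2 D1 D2].
  have [D0 _] := pnorm_comb 0 (fun _ => 0) Dx.
  by rewrite (_ : (fun _ => 0) = (fun k => \sum_(i < 0) 0 * x i k))//; apply/funext => k; rewrite big_ord0.
have Dv i : D (if i == 0%N then z1 else z2) by case: ifP.
have [D12 _] := pnorm_comb 2 (fun i => if i == 0%N then a else b) Dv.
rewrite (_ : (fun k => _) = (fun k => \sum_(i < 2) (if (i : nat) == 0%N then a else b) *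
    (if (i : nat) == 0%N then z1 else z2) k))//.
by apply/funext => k; rewrite big_ord_recl big_ord_recl big_ord0 addr0.
Qed.

Lemma synth_image (a : seqR R) : lp p a -> T (synth x a) = synth y a.
Proof.
move=> la; apply/funext => k; set lhs := T _ k; set rhs := synth y a k.
have x0 i j : (j < N i)%N -> x i j = 0 by move=> /(heads (i := i))[].
have y0 i j : (j < N i)%N -> y i j = 0 by move=> /(heads (i := i))[].
have diff e : 0 < e -> `|lhs - rhs| `^ p <= C * (K * (2 * e)).
  move=> e0; have [N0 hN0] := lp_tail_small la e0; pose n := maxn N0 k.+1.
  pose h i := if (i < n)%N then a i else 0.
  have hE : synth x h = fun j => \sum_(i < n) a i * x i j.
    apply/funext => j; rewrite (@synthE _ _ (n + j.+1))//; last by rewrite leq_addl.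
    rewrite big_split_ord /= [X in _ + X]big1 ?addr0.
      by apply: eq_bigr => i _; rewrite /h ltn_ord.
    by move=> i _; rewrite /h ltnNge leq_addr mul0r.
  have aE : a = fun i => 1 * h i + 1 * tail n a i.
    apply/funext => i; rewrite /h /tail ltnNge !mul1r.
    by case: (n <= i)%N; rewrite ?add0r ?addr0.
  have [Dt Lt] := synth_bounded (fun m => hN0 n m (leq_maxl _ _)).
  have [Dh _] := pnorm_comb n a Dx.
  rewrite /lhs {1}aE synth_lin T_lin ?hE//.
  have [_ ->] := subspace_comb T_lin (@subset_refl _ D) dwp_lin (fun i : 'I_n => a i) (fun i : 'I_n => Dx i).
  rewrite /rhs (@synthE _ _ n)//; last by rewrite leq_max leqnn orbT.
  rewrite !mul1r addrC addKr.
  apply: le_trans (ppow_le_pnorm k (T_dwp Dt)) (le_trans (T_bounded Dt) _).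
  by rewrite ler_pM2l.
apply/eqP; rewrite -subr_eq0; apply/negPn/negP => ne.
have pos : 0 < `|lhs - rhs| `^ p by rewrite powR_gt0// normr_gt0.
have q0 : 0 < C * (K * 2) by rewrite !mulr_gt0.
have e0 : 0 < `|lhs - rhs| `^ p / (C * (K * 2)) / 2 by rewrite !divr_gt0.
have := diff _ e0.
rewrite [in leRHS](_ : C * _ = `|lhs - rhs| `^ p / 2); last first.
  by field; rewrite !gt_eqF.
by rewrite leNgt gtr_pMr// invf_lt1// ltr1n.
Qed.

(* Norming functional of y_i, restricted to r_i and with the weights
   w_(N i), w_(N i + 1), ...: the blocks r_0, ..., r_(i-1) have at most N i
   elements, so all these functionals together use each weight at most once. *)
Definition bump_dual i z : R :=
  wsum w (fun k => Num.sg (y i k) * `|y i k| `^ (p - 1) * z k) (N i) (r i).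

Lemma bump_dual_sum i n (a : nat -> R) (v : nat -> seqR R) :
  bump_dual i (fun k => \sum_(j < n) a j * v j k) = \sum_(j < n) a j * bump_dual i (v j).
Proof.
rewrite /bump_dual (@eq_wsum _ _ _ (fun k => \sum_(j < n)
    a j * (Num.sg (y i k) * `|y i k| `^ (p - 1) * v j k))); last first.
  by move=> k _; rewrite mulr_sumr; apply: eq_bigr => j _; rewrite mulrCA.
by rewrite wsum_sum; apply: eq_bigr => j _; rewrite wsumZ.
Qed.

Lemma bump_dual_lin i (a b : R) z1 z2 :
  bump_dual i (fun k => a * z1 k + b * z2 k) = a * bump_dual i z1 + b * bump_dual i z2.
Proof.
rewrite /bump_dual -!wsumZ -wsumD; apply: eq_wsum => k _; ring.
Qed.

Lemma eq_bump_dual i z1 z2 : (forall k, (N i <= k < N i.+1)%N -> z1 k = z2 k) ->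
  bump_dual i z1 = bump_dual i z2.
Proof. by move=> z12; apply: eq_wsum => k /r_range /z12 ->. Qed.

Lemma bump_dual0 i z : (forall k, (N i <= k < N i.+1)%N -> z k = 0) -> bump_dual i z = 0.
Proof.
move=> z0; rewrite (eq_bump_dual (z2 := fun k => 0 * z k + 0 * z k)).
  by rewrite bump_dual_lin !mul0r addr0.
by move=> k /z0 ->; rewrite !mul0r addr0.
Qed.

Lemma bump_dual_diag i : bump_dual i (y i) = wsum w (ppow (y i)) (N i) (r i).
Proof.
apply: eq_wsum => k _; rewrite /ppow -(mulr_powRB1 (normr_ge0 _) p_gt0).
by rewrite mulrAC -normrEsg.
Qed.

Lemma bump_dual_bound i z :
  `|bump_dual i z| `^ p <= (C + 1) `^ p * wsum w (ppow z) (N i) (r i).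
Proof.
set Z := wsum _ _ _ _; have Z0 : 0 <= Z by apply: wsum_ge0 => // k; exact: ppow_ge0.
have C1 : 0 < C + 1 by rewrite addr_gt0.
have C1p : 0 < (C + 1) `^ p by rewrite powR_gt0.
apply/ler_addgt0Pr => e e0; pose q := Z + e / (C + 1) `^ p.
have q0 : 0 < q by rewrite ltr_wpDl// divr_gt0.
have Zq : Z <= q by rewrite lerDl divr_ge0// ltW.
suff dual_le : `|bump_dual i z| <= (C + 1) * q `^ p^-1.
  apply: le_trans (_ : ((C + 1) * q `^ p^-1) `^ p <= _).
    by apply: ge0_ler_powR; rewrite ?nnegrE ?mulr_ge0 ?powR_ge0 ?(ltW p_gt0) ?(ltW C1).
  rewrite powRM ?powR_ge0 ?(ltW C1)// powR_rootK ?(ltW q0)//.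
  by rewrite /q mulrDr mulrCA divff ?gt_eqF// mulr1.
pose l := q `^ p^-1; have l0 : 0 < l by rewrite powR_gt0.
have lp : l `^ p = q by rewrite powR_rootK// ltW.
have step1 : `|bump_dual i z| <= wsum w (fun k => `|y i k| `^ (p - 1) * `|z k|) (N i) (r i).
  rewrite /bump_dual; elim: (r i) (N i) => [|k s IH] m /=; first by rewrite normr0.
  rewrite (le_trans (ler_normD _ _))// lerD// !normrM (ger0_norm (w_ge0 m)).
  rewrite ler_wpM2l// ler_wpM2r// (ger0_norm (powR_ge0 _ _)) ler_piMl ?powR_ge0//.
  by rewrite normr_sg; case: (_ == _).
apply: le_trans step1 _.
apply: (@le_trans _ _ (wsum w (fun k => l * (ppow (y i) k + q^-1 * ppow z k)) (N i) (r i))).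
  apply: ler_wsum => // k _; rewrite -(ler_pdivrMl _ _ l0) mulrCA.
  apply: le_trans (powR_norm_lin_le1 p_ge1 _ _) _ => //.
    by rewrite mulr_ge0// invr_ge0 ltW.
  rewrite lerD2l powRM ?invr_ge0 ?(ltW l0)// ler_wpM2r ?powR_ge0//.
  by rewrite -(powR_inv1 (ltW l0)) powRAC lp powR_inv1// ltW.
rewrite wsumZ wsumD wsumZ [leRHS]mulrC ler_wpM2l ?(ltW l0)//; apply: lerD.
  apply: le_trans (wsum_anti w_dec _ (ppow_ge0 (y i)) (leq0n _)) _.
  apply: le_trans (wsum_le_pnorm (T_dwp (Dx i)) (r_uniq i)) _.
  by apply: le_trans (T_bounded (Dx i)) _; rewrite Lx mulr1.
by rewrite -/Z mulrC ler_pdivrMr// mul1r.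
Qed.

Lemma bump_dual_sum_bound n z : D z ->
  \sum_(i < n) `|bump_dual i z| `^ p <= (C + 1) `^ p * L z.
Proof.
move=> Dz; apply: (@le_trans _ _ ((C + 1) `^ p *
    \sum_(i < n) wsum w (ppow z) (N i) (r i))).
  by rewrite mulr_sumr; apply: ler_sum => i _; exact: bump_dual_bound.
rewrite ler_wpM2l ?powR_ge0//.
suff [s [us sN sL]] : exists s, [/\ uniq s, forall k, k \in s -> (k < N n)%N &
    \sum_(i < n) wsum w (ppow z) (N i) (r i) <= wsum w (ppow z) 0 s].
  exact: le_trans sL (wsum_le_pnorm Dz us).
elim: n => [|n [s [us sN sL]]]; first by exists [::]; rewrite big_ord0.
exists (s ++ r n); split.
- rewrite cat_uniq us r_uniq andbT /=; apply/hasPn => k /r_range /andP[Nk _].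
  by apply/negP => /sN; rewrite ltnNge Nk.
- move=> k; rewrite mem_cat => /orP[/sN kN|/r_range /andP[]//].
  exact: ltn_trans kN (N_incr n).
rewrite big_ord_recr /= wsum_cat add0n lerD//.
apply: wsum_anti => //; first exact: ppow_ge0.
rewrite -(size_iota 0 (N n)); apply: uniq_leq_size => // k /sN.
by rewrite mem_iota add0n.
Qed.

Lemma bump_dual_diag_gt0 i : 0 < bump_dual i (y i).
Proof. by rewrite bump_dual_diag (lt_le_trans d_gt0). Qed.

Lemma bump_dual_head i j : (i < j)%N -> bump_dual i (y j) = 0.
Proof.
move=> ij; apply: bump_dual0 => k /andP[_ ki].
by have [_] := heads (leq_trans ki (N_mono ij)).
Qed.

Lemma analysis_bounded n (a : seqR R) z : D z ->
  (forall i, \sum_(j < i.+1) bump_dual i (y j) * a j = bump_dual i z) ->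
  \sum_(i < n) `|a i| `^ p <= 2 * K * (C + 1) `^ p / d `^ p * L z.
Proof.
move=> Dz az; set A := \sum_(_ < _) _.
have A0 : 0 <= A by apply: sumr_ge0 => i _; exact: powR_ge0.
pose t j := tail (N j.+1) (y j); have Dt j : D (t j) by have [] := tail_y j.
have [Dh Lh] := pnorm_comb n a Dt; set h := fun k => _ in Dh Lh.
have LhA : L h <= eta * A.
  apply: le_trans Lh _; rewrite mulr_sumr; apply: ler_sum => j _.
  rewrite mulrCA [eta * _]mulrC ler_wpM2l ?powR_ge0//.
  by rewrite mulrC -ler_pdivlMr ?exprn_gt0//; have [] := tail_y j.
have hE (i : 'I_n) : bump_dual i h = \sum_(j < i) bump_dual i (y j) * a j.
  rewrite /h bump_dual_sum -(big_mkord predT (fun j => a j * bump_dual i (t j))).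
  rewrite (@big_cat_nat _ _ _ i)//=; last exact: ltnW.
  rewrite [X in _ + X]big_nat [X in _ + X]big1 ?addr0; last first.
    move=> j /andP[ij _]; rewrite bump_dual0 ?mulr0// => k /andP[_ ki].
    by rewrite /t /tail leqNgt (leq_trans ki (N_mono _)).
  rewrite big_mkord; apply: eq_bigr => j _; rewrite mulrC; congr (_ * _).
  apply: eq_bump_dual => k /andP[ik _].
  by rewrite /t /tail (leq_trans (N_mono (ltn_ord j)) ik).
have term (i : 'I_n) : d `^ p * `|a i| `^ p <= K * (`|bump_dual i z| `^ p + `|bump_dual i h| `^ p).
  have -> : `|bump_dual i h| = `|- bump_dual i h| by rewrite normrN.
  apply: le_trans (powR_normD p_ge1 _ _).
  rewrite -az hE big_ord_recr /= [_ + _ - _]addrAC subrr add0r.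
  rewrite -powRM ?(ltW d_gt0)//; apply: ge0_ler_powR; rewrite ?nnegrE ?mulr_ge0 ?(ltW d_gt0) ?(ltW p_gt0)//.
  by rewrite normrM ler_wpM2r// (gtr0_norm (bump_dual_diag_gt0 _)) bump_dual_diag.
have sum_le : d `^ p * A <= K * ((C + 1) `^ p * L z + (C + 1) `^ p * L h).
  rewrite mulr_sumr; apply: le_trans (ler_sum _ (fun i _ => term i)) _.
  by rewrite -mulr_sumr big_split /= ler_wpM2l ?(ltW K_gt0)// lerD// bump_dual_sum_bound.
have hA : K * ((C + 1) `^ p * L h) <= d `^ p / 2 * A.
  apply: le_trans (_ : K * ((C + 1) `^ p * eta) * A <= _); last by rewrite ler_wpM2r.
  by rewrite -!mulrA !ler_wpM2l ?powR_ge0.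
have dp : 0 < d `^ p by rewrite powR_gt0.
have half_le : d `^ p / 2 * A <= K * ((C + 1) `^ p * L z).
  rewrite -(lerD2r (d `^ p / 2 * A)) -mulrDl -splitr (le_trans sum_le)//.
  by rewrite mulrDr lerD2l.
rewrite (_ : _ / _ * _ = (d `^ p / 2)^-1 * (K * ((C + 1) `^ p * L z))).
  by rewrite ler_pdivlMl// divr_gt0.
by field; rewrite gt_eqF.
Qed.

Lemma bump_analysis : exists V : seqR R -> seqR R,
  forall z i, \sum_(j < i.+1) bump_dual i (y j) * V z j = bump_dual i z.
Proof.
have diag i : bump_dual i (y i) != 0 by rewrite gt_eqF ?bump_dual_diag_gt0.
have [V VE] := choice (fun z =>
  @triangular_surj _ (fun i j => bump_dual i (y j)) diag (fun i => bump_dual i z)).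
by exists V.
Qed.

Lemma lp_factor : exists U V : seqR R -> seqR R,
  [/\ bounded_op (lp p) (lp_norm p) D (dwp_norm w p) U,
      bounded_op D (dwp_norm w p) (lp p) (lp_norm p) V &
      forall a, lp p a -> V (T (U a)) = a].
Proof.
have diag i : bump_dual i (y i) != 0 by rewrite gt_eqF ?bump_dual_diag_gt0.
have [V VE] := bump_analysis; exists (synth x), V.
have Ub (a : seqR R) : lp p a -> D (synth x a) /\ L (synth x a) <= K * (2 * fine (lp_sum p a)).
  by move=> la; apply: synth_bounded => n; exact: partial_le_lp.
pose B := 2 * K * (C + 1) `^ p / d `^ p.
have B0 : 0 <= B by rewrite !mulr_ge0 ?powR_ge0// invr_ge0 powR_ge0.
have Vb z : D z -> lp p (V z) /\ fine (lp_sum p (V z)) <= B * L z.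
  by move=> Dz; apply: lp_of_partial => n; exact: analysis_bounded.
split.
- split; first by move=> a /Ub[].
    by move=> a b e f _ _; exact: synth_lin.
  exists ((K * 2) `^ p^-1) => a la; rewrite /dwp_norm /lp_norm.
  apply: powR_root_mono => //; rewrite ?mulr_ge0 ?(ltW K_gt0) ?fine_ge0 ?lp_sum_ge0 ?lorentz_sum_ge0//.
  by rewrite -mulrA; have [] := Ub _ la.
- split; first by move=> z /Vb[].
    move=> a b z1 z2 _ _; apply: (@triangular_inj _ (fun i j => bump_dual i (y j)) diag) => i.
    rewrite VE bump_dual_lin -!VE !mulr_sumr -big_split /=.
    by apply: eq_bigr => j _; ring.
  exists (B `^ p^-1) => z Dz; apply: powR_root_mono => //; rewrite ?fine_ge0 ?lp_sum_ge0 ?lorentz_sum_ge0//.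
  by have [] := Vb _ Dz.
move=> a la; rewrite synth_image//; apply: (@triangular_inj _ (fun i j => bump_dual i (y j)) diag) => i.
have y0 l j : (j < N l)%N -> y l j = 0 by move=> /(heads (i := l))[].
rewrite VE (eq_bump_dual (z2 := fun k => \sum_(j < N i.+1) a j * y j k)); last first.
  by move=> k /andP[_ kN]; rewrite (@synthE _ _ (N i.+1)).
rewrite bump_dual_sum -(big_mkord predT (fun j => a j * bump_dual i (y j))).
rewrite (@big_cat_nat _ _ _ i.+1)//=; last exact: N_ge.
rewrite [X in _ + X]big_nat [X in _ + X]big1 ?addr0; last first.
  by move=> j /andP[ij _]; rewrite bump_dual_head ?mulr0.
by rewrite big_mkord; apply: eq_bigr => j _; rewrite mulrC.
Qed.

End BumpSequence.

Lemma lp_factor_of_iso T M : bounded_op D (dwp_norm w p) D (dwp_norm w p) T ->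
  M `<=` D -> lin_subspace M -> infinite_dim M -> iso_on (dwp_norm w p) T M ->
  exists U V : seqR R -> seqR R,
  [/\ bounded_op (lp p) (lp_norm p) D (dwp_norm w p) U,
      bounded_op D (dwp_norm w p) (lp p) (lp_norm p) V &
      forall a, lp p a -> V (T (U a)) = a].
Proof.
move=> bT MD Mlin Minf Miso; have [C C0 TC] := bounded_dwp bT.
have [c c0 Tc] := iso_on_dwp Miso; have [T_dwp T_lin _] := bT.
have d0 : 0 < c / 2 by rewrite divr_gt0.
have K0 : 0 < K :> R by rewrite powR_gt0.
have Q0 : 0 < K * (C + 1) `^ p by rewrite mulr_gt0 ?powR_gt0 ?addr_gt0.
have dp0 : 0 < (c / 2) `^ p / 2 by rewrite divr_gt0 ?powR_gt0.
pose eta := Num.min 1 ((c / 2) `^ p / 2 / (K * (C + 1) `^ p)).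
have eta0 : 0 < eta by rewrite lt_min ltr01 divr_gt0.
have eta1 : eta <= 1 by rewrite ge_min lexx.
have etaS : K * ((C + 1) `^ p * eta) <= (c / 2) `^ p / 2.
  by rewrite mulrA mulrC -ler_pdivlMr// ge_min lexx orbT.
have eps0 i : 0 < eta / K ^+ i.+1 by rewrite divr_gt0// exprn_gt0.
have [f fP] := choice (fun iN : nat * nat =>
  exists_bump C0 c0 T_dwp T_lin TC MD Mlin Minf Tc iN.2 (eps0 iN.1)).
pose N := fix N i := if i is j.+1 then (f (j, N j)).2 else 0%N.
pose x i := (f (i, N i)).1.1; pose r i := (f (i, N i)).1.2.
have spec i : bump_spec T M c (N i) (eta / K ^+ i.+1) (x i, r i, N i.+1).
  by have := fP (i, N i); rewrite /x /r /=; case: (f _) => [[? ?] ?].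
apply: (@lp_factor T C (c / 2) C0 d0 T_dwp T_lin TC eta x r N) => //.
- by move=> i; have [[/MD]] := spec i.
- by move=> i; have [[]] := spec i.
- by move=> i; have [] := spec i.
- by move=> i; have [_ _ []] := spec i.
- by move=> i; have [_ _ []] := spec i.
- by move=> i; have [_ _ []] := spec i.
- by move=> i; have [] := spec i.
- by move=> i; have [_ _ _ _ [tx _]] := spec i; exact: tx.
- by move=> i; have [_ _ _ _ [_ ty]] := spec i; exact: ty.
Qed.

End Lorentz.

Lemma bounded_op_comp (R : realType) (X Y Z : set (seqR R)) (nX nY nZ : seqR R -> R)
    (A B : seqR R -> seqR R) : (forall y, 0 <= nY y) ->
  bounded_op X nX Y nY A -> bounded_op Y nY Z nZ B -> bounded_op X nX Z nZ (B \o A).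
Proof.
move=> nY0 [XY Alin [a ha]] [YZ Blin [b hb]]; split=> [x /XY/YZ//|s t x y Xx Xy /=|].
  by rewrite Alin// Blin//; exact: XY.
exists (`|b| * a) => x Xx /=; apply: le_trans (hb _ (XY _ Xx)) _.
by rewrite (le_trans (ler_wpM2r (nY0 _) (ler_norm b)))// -mulrA ler_wpM2l// ha.
Qed.

Theorem theorem3p1 (R : realType) (p : R) (w : seqR R)
  (hp : 1 <= p)
  (hw1 : w 0%N = 1)
  (hwdec : forall n : nat, w n.+1 <= w n)
  (hw0 : (w n) @[n --> \oo] --> (0 : R))
  (hwdiv : (\sum_(0 <= n <oo) ((w n)%:E))%E = +oo%E)
  (T : seqR R -> seqR R)
  (hT : bounded_op (dwp w p) (dwp_norm w p) (dwp w p) (dwp_norm w p) T)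
  (hTnss : ~ strictly_singular (dwp w p) (dwp_norm w p) T) :
  forall S : seqR R -> seqR R, in_Jlp w p S -> in_JT w p T S.
Proof.
have [M [MD Mlin Minf Miso]] : exists M : set (seqR R),
    [/\ M `<=` dwp w p, lin_subspace M, infinite_dim M & iso_on (dwp_norm w p) T M].
  apply: contrapT => h; apply: hTnss => M MD Mlin _ Minf Miso.
  by apply: h; exists M.
have [U [V [bU bV VTU]]] := lp_factor_of_iso hp hw1 hwdec hw0 hwdiv hT MD Mlin Minf Miso.
move=> S [A [B [bA bB SE]]].
exists 1%N, (fun=> B \o V), (fun=> U \o A); split=> [_|].
  by apply: bounded_op_comp bV bB => x; exact: powR_ge0.
split=> [_|x Dx]; first by apply: bounded_op_comp bA bU => x; exact: powR_ge0.
rewrite SE//; apply/funext => k; rewrite big_ord1 /= VTU//.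
by case: bA => + _ _; exact.
Qed.
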